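(* Consider federated learning over a set $\mathcal{S}$ of participating clients, indexed $n=1,\dots,|\mathcal{S}|$, with aggregation weights $\alpha_n$, local loss functions $\mathcal{L}_n$, global loss $\mathcal{L}(x)=\sum_{n\in\mathcal{S}}\alpha_n\mathcal{L}_n(x)$ and learning rate $\eta$. Let $g_n(w)$ denote the stochastic gradient of client $n$ at $w$. Assume: (1) (smoothness) the (non-convex) loss of the clients is $\beta$-smooth, with $\beta$ a constant: $\|\nabla\mathcal{L}(w_1)-\nabla\mathcal{L}(w_2)\|\le\beta\|w_1-w_2\|$ for all $w_1,w_2$; (2) (unbiased gradient) $\mathbb{E}_{\xi|D_n}[g_n(w)]=\nabla\mathcal{L}_n(w)$ for all $n$ and all $w$, where $\xi$ is a random batch from the local dataset $D_n$ of client $n$; (3) (bounded variance) $\mathbb{E}\left[\|g_n(w)-\nabla\mathcal{L}_n(w)\|^2\right]\le\sigma^2$ for all $n$ and all $w$. Let the central model be updated by $$x(t+1)=x(t)-\eta\sum_{n=1}^{|\mathcal{S}|}\alpha_n\,g_n(x_n(t)),$$ where $x(t)$ is the central model and $x_n(t)$ the local model of client $n$ at time $t$. Then the expected loss of the central model at time $t+1$ is upper-bounded by $$\mathbb{E}[\mathcal{L}(x(t+1))]\le\mathbb{E}[\mathcal{L}(x(t))]-\frac{\eta}{2}\mathbb{E}\left[\|\nabla\mathcal{L}(x(t))\|^2\right]+\frac{\eta^2\beta}{2}\sigma^2\sum_{n=1}^{|\mathcal{S}|}\alpha_n^2+\frac{\eta}{2}\sum_{n=1}^{|\mathcal{S}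|}\alpha_n\,\mathbb{E}\left[\|\nabla\mathcal{L}(x(t))-\nabla\mathcal{L}_n(x_n(t))\|^2\right].$$
   Context: Setting: federated learning with low-rank adaptation (LoRA). In each communication round a server sends its central model $x(t)$ to the selected set $\mathcal{S}$ of clients (vehicles); client $n$ holds a local dataset $D_n$ and a local model $x_n(t)$, in which the distributed weights are frozen and only a low-rank product $B_nA_n$ added to them is trained; the server then aggregates the local updates with weights $\alpha_n$. $\nabla\mathcal{L}(x(t))$ is the gradient of the central model, and $\nabla\mathcal{L}_n(x_n(t))$ is the gradient of the local model of client $n$.
   Formalization: Added, as the bound fails without them: 0 < η and ηβ ≤ 1; weights α_n ≥ 0 summing to 1; batches independent across clients and of the current models. Also assumed so the terms make sense: differentiable losses, measurable g_n, finite E|L(x(t))| and E‖∇L(x(t))‖². *)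

(* Defs.v *)
From HB Require Import structures.
From mathcomp Require Import all_boot all_order all_algebra.
From mathcomp Require Import all_classical all_reals all_analysis.

Set Implicit Arguments.
Unset Strict Implicit.
Unset Printing Implicit Defensive.

Import Order.TTheory GRing.Theory Num.Theory.
Import numFieldNormedType.Exports.

Local Open Scope classical_set_scope.
Local Open Scope ring_scope.

(* 'rV[R]_d with its Borel sigma-algebra, generated by the open sets. *)
Section borel_row_vectors.
Context (R : realType) (d : nat).

Let borel : set (set 'rV[R]_d) := <<s [set U : set 'rV[R]_d | open U] >>.

Let borel0 : borel set0.
Proof. exact: sigma_algebra0. Qed.

Let borelC A : borel A -> borel (~` A).
Proof. exact: sigma_algebraC. Qed.

Let borel_bigcup (F : (set 'rV[R]_d)^nat) :
  (forall i, borel (F i)) -> borel (\bigcup_i F i).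
Proof. exact: sigma_algebra_bigcup. Qed.

HB.instance Definition _ := @isMeasurable.Build
  (sigma_display [set U : set 'rV[R]_d | open U]) 'rV[R]_d
  borel borel0 borelC borel_bigcup.

End borel_row_vectors.

(* Euclidean norm; the library's norm `|v| on 'rV[R]_d is the sup norm. *)
Definition enorm (R : realType) (d : nat) (v : 'rV[R]_d) : R :=
  Num.sqrt (\sum_i v ord0 i ^+ 2).

(* Gradient for the Euclidean inner product, of a differentiable function. *)
Definition grad (R : realType) (d : nat) (f : 'rV[R]_d -> R) (w : 'rV[R]_d) :
    'rV[R]_d :=
  \row_i 'D_(delta_mx ord0 i) f w.

Definition global_loss (R : realType) (d N : nat) (alpha : 'I_N -> R)
    (Ln : 'I_N -> 'rV[R]_d -> R) (w : 'rV[R]_d) : R :=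
  \sum_n alpha n * Ln n w.

Definition mutually_independent (R : realType) (dT : measure_display)
    (T : measurableType dT) (P : probability T R) (I : finType)
    (F : I -> set (set T)) : Prop :=
  forall (J : {set I}) (A : I -> set T),
    (forall i, i \in J -> F i (A i)) ->
    (P (\bigcap_(i in [set i | i \in J]) A i) = \prod_(i in J) P (A i))%E.

(* Sigma-algebra generated jointly by the central and the local models. *)
Definition sigma_models (R : realType) (d N : nat) (dT : measure_display)
    (T : measurableType dT) (x : T -> 'rV[R]_d) (xl : 'I_N -> T -> 'rV[R]_d) :
    set (set T) :=
  <<s g_sigma_algebra_preimage x `|`
      \bigcup_n g_sigma_algebra_preimage (xl n) >>.

(* Sampling scheme of a round: the batch xi n follows the batch law D n of
   client n, and the batches are independent of one another and of the models
   (index None) held at the start of the round. *)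
Definition fresh_batches (R : realType) (d N : nat) (dT dB : measure_display)
    (T : measurableType dT) (B : measurableType dB) (P : probability T R)
    (D : 'I_N -> probability B R)
    (x : {RV P >-> 'rV[R]_d}) (xl : 'I_N -> {RV P >-> 'rV[R]_d})
    (xi : 'I_N -> {RV P >-> B}) : Prop :=
  (forall n (A : set B), measurable A -> distribution P (xi n) A = D n A) /\
  mutually_independent P (fun k : option 'I_N =>
    if k is Some n then g_sigma_algebra_preimage (xi n)
    else sigma_models x xl).

(* Main.v *)
(** Idea.  Write g_n = h_n + e_n with h_n the gradient of L_n at the local model,
    H and E for the alpha-weighted sums of h_n and e_n, and G for the gradient of
    L at x(t).  The descent lemma bounds L(x - eta (H + E)) by
    L(x) - eta <G, H + E> + (eta^2 beta / 2) |H + E|^2.  Polarizing <G, H>, the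
    terms in |H|^2 have total coefficient -(eta / 2) (1 - eta beta) <= 0, and
    |G - H|^2 <= sum alpha_n |G - h_n|^2 by convexity.  What remains is the cross
    term <G - eta beta H, E>, whose expectation vanishes because the batches are
    fresh, and E|E|^2 <= sigma^2 sum alpha_n^2, since distinct e_n are
    uncorrelated. *)

From HB Require Import structures.
Require Import Defs.
From mathcomp Require Import all_boot all_order all_algebra.
From mathcomp Require Import all_classical all_reals all_analysis.
From mathcomp Require Import measurable_realfun ring lra.
Set Implicit Arguments.
Unset Strict Implicit.
Import Order.TTheory GRing.Theory Num.Theory.
Import numFieldNormedType.Exports.
Local Open Scope classical_set_scope.
Local Open Scope ring_scope.

(** * Descent lemma *)

Lemma enorm_sqr (R : realType) (d : nat) (v : 'rV[R]_d) :
  enorm v ^+ 2 = \sum_i v ord0 i ^+ 2.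
Proof. by rewrite sqr_sqrtr// sumr_ge0// => i _; rewrite sqr_ge0. Qed.

Lemma enormZ (R : realType) (d : nat) (c : R) (v : 'rV[R]_d) :
  0 <= c -> enorm (c *: v) = c * enorm v.
Proof.
move=> c0; rewrite /enorm -[in RHS](ger0_norm c0) -sqrtr_sqr -sqrtrM ?sqr_ge0// mulr_sumr.
by congr Num.sqrt; apply: eq_bigr => i _; rewrite mxE exprMn.
Qed.

Lemma derive_grad (R : realType) (d : nat) (f : 'rV[R]_d -> R) (w v : 'rV[R]_d) :
  differentiable f w -> 'D_v f w = \sum_i grad f w ord0 i * v ord0 i.
Proof.
move=> df; rewrite deriveE// [in LHS](row_sum_delta v) linear_sum.
apply: eq_bigr => i _; rewrite linearZ /= mulrC /grad mxE.
by rewrite deriveE.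
Qed.

(** Summing 0 <= (a_i - c v_i)^2 over the coordinates gives 2c <a, v> <= |a|^2 + c^2 |v|^2 <= 2 c^2
    |v|^2, to be divided by 2c. When c = 0 the hypothesis forces a = 0. *)
Lemma sum_mul_le_of_enorm_le (R : realType) (d : nat) (c : R)
    (a v : 'rV[R]_d) : 0 <= c -> enorm a <= c * enorm v ->
  \sum_i a ord0 i * v ord0 i <= c * enorm v ^+ 2.
Proof.
move=> c0 av.
have {av} : enorm a ^+ 2 <= c ^+ 2 * enorm v ^+ 2.
  by rewrite -exprMn ler_pXn2r ?nnegrE ?mulr_ge0 ?sqrtr_ge0.
rewrite le_eqVlt in c0; case/orP: c0 => [/eqP<-|c0] av.
  rewrite expr0n/= !mul0r in av *.
  rewrite big1// => i _; suff -> : a ord0 i = 0 by rewrite mul0r.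
  apply/eqP; rewrite -sqrf_eq0 eq_le sqr_ge0 andbT (le_trans _ av)//.
  by rewrite enorm_sqr (bigD1 i)//= lerDl sumr_ge0// => j _; rewrite sqr_ge0.
rewrite -(ler_pM2l c0) mulrA -expr2.
suff : c * (\sum_i a ord0 i * v ord0 i) *+ 2 <= enorm a ^+ 2 + c ^+ 2 * enorm v ^+ 2.
  lra.
rewrite !enorm_sqr !mulr_sumr -sumrMnl -big_split/=; apply: ler_sum => i _.
by have := sqr_ge0 (a ord0 i - c * v ord0 i); nra.
Qed.

(** On the segment from [w] to [w + v], subtract from [f] the quadratic that the bound allows. The
    difference [phi] has nonpositive derivative on [0, 1] because the gradient is Lipschitz, so the
    mean value theorem gives phi(1) <= phi(0). *)
Lemma descent (R : realType) (d : nat) (beta : R) (f : 'rV[R]_d -> R) :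
  0 <= beta -> (forall w, differentiable f w) ->
  (forall w1 w2, enorm (grad f w1 - grad f w2) <= beta * enorm (w1 - w2)) ->
  forall w v, f (w + v) <=
    f w + \sum_i grad f w ord0 i * v ord0 i + beta / 2 * enorm v ^+ 2.
Proof.
move=> beta0 df fL w v.
set p := \sum_i _; set q := enorm v ^+ 2.
pose phi (s : R) : R := f (s *: v + w) - (p * s + beta / 2 * q * s ^+ 2).
have line s : is_derive s (1:R) (fun s : R => f (s *: v + w))
    (\sum_i grad f (s *: v + w) ord0 i * v ord0 i).
  (* Difference quotients of s |-> f(s v + w) at s are those of [f] at s v + w in direction [v], so
     the derivative along the line is a directional derivative. *)
  have E : (fun h : R => h^-1 *: (((fun s : R => f (s *: v + w)) \o shift s)
      (h *: (1 : R)) - f (s *: v + w))) =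
    (fun h : R => h^-1 *: ((f \o shift (s *: v + w)) (h *: v) - f (s *: v + w))).
    by apply/funext => h /=; rewrite [_ *: 1]mulr1 scalerDl addrA.
  have df' := @diff_derivable _ _ _ f (s *: v + w) v (df _).
  apply: DeriveDef; first by rewrite /derivable E.
  by rewrite -derive_grad// /derive E.
have dphi s : is_derive s (1:R) phi ((\sum_i grad f (s *: v + w) ord0 i * v ord0 i)
   - (p + beta * q * s)).
  pose pol : R -> R := p \*: id + (beta / 2 * q) \*: (id * id).
  have -> : phi = (fun s : R => f (s *: v + w)) - pol.
    by apply/funext => r.
  apply: is_derive_eq.
  by rewrite /GRing.scale/=; congr (_ - _); field.
have cphi : {within `[(0:R), 1], continuous phi}.
  apply: derivable_within_continuous => s _; exact: (@ex_derive _ _ _ _ _ _ _ (dphi s)).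
have [s /[!in_itv]/= /andP[s0 s1]] :=
  @MVT_segment R phi _ 0 1 ler01 (fun s _ => dphi s) cphi.
rewrite /phi scale0r scale1r add0r (addrC v w).
have : \sum_i grad f (s *: v + w) ord0 i * v ord0 i - p <= beta * s * q.
  rewrite /p -sumrB (eq_bigr (fun i =>
    (grad f (s *: v + w) - grad f w) ord0 i * v ord0 i)); last first.
    by move=> i _; rewrite !mxE mulrBl.
  apply: sum_mul_le_of_enorm_le; first exact: mulr_ge0.
  by rewrite (le_trans (fL _ _))// addrK enormZ// mulrA.
move=> ? ?; lra.
Qed.

(** * Borel measurability of gradients *)

Lemma continuous_measurable_rV (R : realType) (d : nat) (f : 'rV[R]_d -> R) :
  continuous f -> measurable_fun [set: 'rV[R]_d] f.
Proof.
move=> /continuousP cf; apply: (measurability _ (RGenOpens.measurableE R)).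
move=> _ [_ [a [b ->] <-]]; rewrite setTI; apply: sub_sigma_algebra.
exact/cf/interval_open.
Qed.

Lemma measurable_coord (R : realType) (d : nat) (i : 'I_d) :
  measurable_fun [set: 'rV[R]_d] (fun w : 'rV[R]_d => w ord0 i).
Proof. by apply: continuous_measurable_rV; exact: coord_continuous. Qed.

(** A partial derivative is the pointwise limit of the difference quotients [q n] with step 1/(n+1),
    each of which is continuous because [f] is. *)
Lemma measurable_grad (R : realType) (d : nat) (f : 'rV[R]_d -> R) (i : 'I_d) :
  (forall w, differentiable f w) ->
  measurable_fun [set: 'rV[R]_d] (fun w : 'rV[R]_d => grad f w ord0 i).
Proof.
move=> df.
have cf : continuous f by move=> w; exact: differentiable_continuous.
pose e : 'rV[R]_d := delta_mx ord0 i.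
pose q (n : nat) (w : 'rV[R]_d) : R := n.+1%:R * (f (n.+1%:R^-1 *: e + w) - f w).
apply: (@measurable_fun_cvg _ _ _ _ q) => [n|w _].
  apply: continuous_measurable_rV => w.
  apply: (@continuousM _ _ (cst n.+1%:R) (fun w => f (n.+1%:R^-1 *: e + w) - f w)).
    exact: cst_continuous.
  apply: (@continuousB _ _ _ (fun w => f (n.+1%:R^-1 *: e + w)) f); last exact: cf.
  apply: (@continuous_comp _ _ _ (fun w => n.+1%:R^-1 *: e + w) f); last exact: cf.
  apply: (@continuousD _ _ _ (cst _) id); first exact: cst_continuous.
  by move=> ?.
rewrite /grad mxE.
have := @diff_derivable _ _ _ f w e (df w).
rewrite /derivable => /= /cvg_ex[l fl].
rewrite /derive (cvg_lim _ fl)//.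
(* The limit through nonzero steps tending to 0 is read along the sequence 1/(n+1). *)
have /cvgr_dnbhsP/(_ (@harmonic R)) := fl.
move=> /(_ (conj (fun n => lt0r_neq0 (harmonic_gt0 n)) cvg_harmonic)).
apply: cvg_trans; apply: near_eq_cvg; near=> n => /=.
by rewrite /harmonic/= invrK.
Unshelve. all: by end_near.
Qed.

(** * Fresh samples *)

(* With A = setT this says that X has law D; X is then independent of Z. *)
Definition fresh_sample (R : realType) (dT dS dB : measure_display)
    (T : measurableType dT) (S : measurableType dS) (B : measurableType dB)
    (P : probability T R) (Z : T -> S) (X : T -> B) (D : probability B R) : Prop :=
  forall (A : set S) (C : set B), measurable A -> measurable C ->
    (P (Z @^-1` A `&` X @^-1` C) = P (Z @^-1` A) * D C)%E.

Section fresh_sample_theory.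
Local Open Scope ereal_scope.
Context (R : realType) (dT dS dB : measure_display)
  (T : measurableType dT) (S : measurableType dS) (B : measurableType dB)
  (P : probability T R) (Z : {mfun T >-> S}) (X : {mfun T >-> B})
  (D : probability B R).

Let ZX (u : T) : S * B := (Z u, X u).
Let mZX : measurable_fun setT ZX.
Proof. exact: measurable_fun_pair. Qed.
HB.instance Definition _ := isMeasurableFun.Build _ _ _ _ ZX mZX.

Hypothesis ZXD : fresh_sample P Z X D.

(** [ZXD] is the product formula on measurable rectangles, which determines the product measure. *)
Lemma fresh_sample_joint_law (W : set (S * B)) : measurable W ->
  distribution P ZX W = (distribution P Z \x D) W.
Proof.
by move=> mW; apply/esym/product_measure_unique.
Qed.

Lemma ge0_integral_fresh_sample (f : S * B -> \bar R) :
  measurable_fun setT f -> (forall p, 0 <= f p) ->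
  \int[P]_u f (Z u, X u) = \int[distribution P Z]_z \int[D]_b f (z, b).
Proof.
move=> mf f0; rewrite -fubini_tonelli1//.
transitivity (\int[distribution P ZX]_p f p).
  by rewrite ge0_integral_distribution.
by apply: eq_measure_integral => W mW _; exact: fresh_sample_joint_law.
Qed.

(** Fubini under the product law, integrating over the batch first: every inner integral is zero. *)
Lemma integral_fresh_sample_centered (f : S * B -> \bar R) :
  measurable_fun setT f -> P.-integrable setT (fun u => f (Z u, X u)) ->
  (forall z, \int[D]_b f (z, b) = 0) ->
  \int[P]_u f (Z u, X u) = 0.
Proof.
move=> mf fi f0.
transitivity (\int[distribution P ZX]_p f p).
  by rewrite integral_distribution.
transitivity (\int[distribution P Z \x D]_p f p).
  by apply: eq_measure_integral => W mW _; exact: fresh_sample_joint_law.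
(* Integrability under the product law comes from integrability under [P], by the Tonelli formula
   for the absolute value of [f]. *)
rewrite -integral12_prod_meas1; last first.
  apply/integrableP; split => //.
  rewrite fubini_tonelli1//; last exact: measurableT_comp.
  rewrite -(@ge0_integral_fresh_sample (abse \o f)).
  - by move/integrableP : fi => [].
  - exact: measurableT_comp.
  - by move=> p; exact: abse_ge0.
by rewrite (_ : fubini_F _ _ = cst 0) ?integral0//; exact/funext.
Qed.

End fresh_sample_theory.

(* Allows a first batch to be absorbed into the past of a second one. *)
Lemma fresh_sample_pair (R : realType) (dT dS d1 d2 : measure_display)
    (T : measurableType dT) (S : measurableType dS)
    (B1 : measurableType d1) (B2 : measurableType d2) (P : probability T R)
    (Z : {mfun T >-> S}) (X : {mfun T >-> B1}) (Y : {mfun T >-> B2})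
    (D1 : probability B1 R) (D2 : probability B2 R) :
  (forall (A : set S) (C : set B1) (E : set B2),
    measurable A -> measurable C -> measurable E ->
    (P (Z @^-1` A `&` (X @^-1` C `&` Y @^-1` E)) = P (Z @^-1` A) * (D1 C * D2 E))%E) ->
  fresh_sample P (fun u => (Z u, X u)) Y D2.
Proof.
move=> ZXY.
have ZX : fresh_sample P Z X D1.
  move=> A C mA mC; have := ZXY A C setT mA mC measurableT.
  by rewrite preimage_setT setIT probability_setT mule1.
have mZX : measurable_fun setT (fun u => (Z u, X u)) by exact: measurable_fun_pair.
move=> W E mW mE.
have mYE : measurable (Y @^-1` E) by rewrite -[_ @^-1` _]setTI; exact: measurable_funP.
have D2E : D2 E = (fine (D2 E))%:E by rewrite fineK// fin_num_measure.
have D2E0 : 0 <= fine (D2 E) by rewrite fine_ge0.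
(* With [E] fixed, two measures in [W] are compared: [P] restricted to the event that Y lies in [E]
   and pushed forward by (Z, X), and [D2 E] times the law of (Z, X). On rectangles both agree with
   the product of the law of Z and [m2], hence they are equal. *)
pose m2 : {finite_measure set B1 -> \bar R} := mscale (NngNum D2E0) D1.
pose ZXm : {mfun T >-> (S * B1)%type} := HB.pack (fun u => (Z u, X u))
  (isMeasurableFun.Build _ _ _ _ (fun u => (Z u, X u)) mZX).
pose r := NngNum D2E0.
have e1 := @product_measure_unique _ _ _ _ R (distribution P Z) m2
  (pushforward (mrestr P mYE) ZXm).
have e2 := @product_measure_unique _ _ _ _ R (distribution P Z) m2
  (mscale r (distribution P ZXm)).
transitivity (((distribution P Z) \x m2)%E W).
  apply/esym/e1 => // A C mA mC.
  rewrite [RHS](_ : _ = P (Z @^-1` A) * ((fine (D2 E))%:E * D1 C))%E//.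
  by rewrite -D2E (muleC (D2 E)) -ZXY// setIA.
rewrite e2//.
  by rewrite [LHS](_ : _ = (fine (D2 E))%:E * P (ZXm @^-1` W))%E// -D2E muleC.
move=> A C mA mC.
rewrite [RHS](_ : _ = P (Z @^-1` A) * ((fine (D2 E))%:E * D1 C))%E//.
by rewrite muleCA -ZX.
Qed.

(** * Square-integrable random variables *)

(** The variance of [y] under the weights [a], taken around the mean [m], is nonnegative. *)
Lemma sqr_convex_sum (R : realType) (I : finType) (a y : I -> R) :
  (forall i, 0 <= a i) -> \sum_i a i = 1 ->
  (\sum_i a i * y i) ^+ 2 <= \sum_i a i * y i ^+ 2.
Proof.
move=> a0 a1; set m := \sum_i a i * y i.
have : 0 <= \sum_i a i * (y i - m) ^+ 2.
  by apply: sumr_ge0 => i _; rewrite mulr_ge0// sqr_ge0.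
rewrite (eq_bigr (fun i => a i * y i ^+ 2 - (2 * m) * (a i * y i) + m ^+ 2 * a i));
  last by move=> i _; ring.
rewrite big_split/= sumrB -!mulr_sumr a1 -/m.
by move=> ?; nra.
Qed.

Section square_integrable.
Context (R : realType) (dT : measure_display) (T : measurableType dT)
  (P : probability T R).

Lemma Lfun2_expectation_sqr (f : T -> R) : measurable_fun setT f ->
  ('E_P[fun u => (f u ^+ 2)%R] < +oo)%E -> f \in Lfun P 2%:E.
Proof.
move=> mf; rewrite unlock => foo.
rewrite inE; apply/andP; split; rewrite inE//= /finite_norm unlock/=.
apply: poweR_lty; apply: le_lt_trans foo.
rewrite le_eqVlt; apply/orP; left; apply/eqP/eq_integral => u _ /=.
by rewrite powR_mulrn// -normrX ger0_norm// sqr_ge0.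
Qed.

Lemma Lfun_measurable (f : T -> R) p : f \in Lfun P p -> measurable_fun setT f.
Proof. by move=> /sub_Lfun_mfun /set_mem. Qed.

Lemma expectation_bigsum (I : finType) (f : I -> T -> R) :
  (forall i, f i \in Lfun P 1) ->
  ('E_P[fun u => (\sum_i f i u)%R] = \sum_i 'E_P[f i])%E.
Proof.
move=> fL.
transitivity ('E_P[(\sum_(h <- map f (index_enum I)) h)%R])%E.
  by congr ('E_P[_])%E; apply/funext => u; rewrite big_map fct_sumE.
rewrite expectation_sum ?big_map// => h /mapP[i _ ->]; exact: fL.
Qed.

Lemma Lfun_bigsum (I : finType) (p : \bar R) (p1 : (1 <= p)%E) (f : I -> T -> R) :
  (forall i, f i \in Lfun P p) -> (fun u => \sum_i f i u) \in Lfun P p.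
Proof.
move=> fL; rewrite (_ : (fun _ => _) = \sum_i f i); last first.
  by apply/funext => u; rewrite fct_sumE.
exact: rpred_sum.
Qed.

Lemma expectation_mull (k : R) (f : T -> R) : f \in Lfun P 1 ->
  ('E_P[fun u => (k * f u)%R] = k%:E * 'E_P[f])%E.
Proof.
move=> fL; rewrite -expectationZl//.
by congr ('E_P[_])%E; apply/funext => u /=; rewrite mulrC.
Qed.

Lemma Lfun_mull (p : \bar R) (p1 : (1 <= p)%E) (k : R) (f : T -> R) :
  f \in Lfun P p -> (fun u => k * f u) \in Lfun P p.
Proof.
by move=> fL; rewrite (_ : (fun _ => _) = k *: f)//; exact: rpredZ.
Qed.

(** Passes from a moment bound on a Euclidean norm to its coordinates, each square being dominated
    by the whole sum. *)
Lemma Lfun2_expectation_sum_sqr (I : finType) (f : I -> T -> R) :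
  (forall i, measurable_fun setT (f i)) ->
  ('E_P[fun u => (\sum_i f i u ^+ 2)%R] < +oo)%E ->
  forall i, f i \in Lfun P 2%:E.
Proof.
move=> mf foo i; apply: Lfun2_expectation_sqr => //; apply: le_lt_trans foo.
rewrite unlock; apply: ge0_le_integral => //.
- by move=> u _; rewrite lee_fin sqr_ge0.
- by apply/measurable_EFinP; exact: measurable_funX.
- by apply/measurable_EFinP; apply: measurable_sum => j; exact: measurable_funX.
move=> u _; rewrite lee_fin (bigD1 i)//= lerDl.
by apply: sumr_ge0 => j _; rewrite sqr_ge0.
Qed.

(** Meant for the loss at the new central model, which is only bounded above by an integrable
    function, so that its expectation could be -oo. Positive and negative parts are compared
    separately. *)
Lemma expectation_le_Lfun1 (f h : T -> R) : measurable_fun setT f ->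
  h \in Lfun P 1 -> (forall u, f u <= h u) -> ('E_P[f] <= 'E_P[h])%E.
Proof.
move=> mf /[dup] /Lfun_measurable mh hL fh; rewrite unlock.
rewrite integralE [leRHS]integralE leeB//.
- apply: ge0_le_integral => //.
  + by apply: measurable_funepos; exact/measurable_EFinP.
  + by apply: measurable_funepos; exact/measurable_EFinP.
  + by move=> u _; apply: (@funepos_le _ _ setT); rewrite ?inE// => v _; rewrite lee_fin.
- apply: ge0_le_integral => //.
  + by apply: measurable_funeneg; exact/measurable_EFinP.
  + by apply: measurable_funeneg; exact/measurable_EFinP.
  + by move=> u _; apply: (@funeneg_le _ _ setT); rewrite ?inE// => v _; rewrite lee_fin.
Qed.

End square_integrable.

(** * Independence of the batches from the models *)

Section fresh_batches_theory.
Context (R : realType) (d N : nat) (dT dB : measure_display)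
  (T : measurableType dT) (B : measurableType dB) (P : probability T R)
  (D : 'I_N -> probability B R)
  (x : {RV P >-> 'rV[R]_d}) (xl : 'I_N -> {RV P >-> 'rV[R]_d})
  (xi : 'I_N -> {RV P >-> B}).

(* T with the coarser sigma-algebra generated by the models: a function on it is
   measurable iff it depends measurably on the models only. *)
Definition model_space := g_sigma_algebraType
  (g_sigma_algebra_preimage x `|` \bigcup_n g_sigma_algebra_preimage (xl n)).
HB.instance Definition _ := Measurable.on model_space.

Definition to_model_space (u : T) : model_space := u.

Let measurable_to_model_space : measurable_fun setT to_model_space.
Proof.
move=> _ A mA; rewrite setTI.
have := smallest_sub (sigma_algebra_measurable T) _ mA; apply.
move=> _ [|[n _]] [C mC <-]; rewrite setTI -[_ @^-1` _]setTI; exact: measurable_funP.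
Qed.

HB.instance Definition _ :=
  isMeasurableFun.Build _ _ _ _ to_model_space measurable_to_model_space.

Lemma measurable_central :
  measurable_fun [set: model_space] (x : model_space -> 'rV[R]_d).
Proof.
by move=> _ C mC; apply: sub_sigma_algebra; left; exists C.
Qed.

Lemma measurable_local n :
  measurable_fun [set: model_space] (xl n : model_space -> 'rV[R]_d).
Proof.
by move=> _ C mC; apply: sub_sigma_algebra; right; exists n => //; exists C.
Qed.

Hypothesis fresh : fresh_batches D x xl xi.

(** Mutual independence on the indices [None] and [Some n]: the measurable sets of [model_space] are
    exactly the events attached to [None]. *)
Lemma fresh_batch n : fresh_sample P to_model_space (xi n) (D n).
Proof.
move=> A C mA mC; have [law ind] := fresh.
rewrite -law//.
have := ind [set None; Some n]%SET
  (fun k => if k is Some _ then xi n @^-1` C else A).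
rewrite big_setU1/= ?inE// big_set1 => <-.
  congr (P _); apply/seteqP; split => u.
    by move=> [Au Cu] [k|] _.
  by move=> h; split; [apply: (h None)|apply: (h (Some n))]; rewrite /= !inE// eqxx.
by move=> [k|]; rewrite !inE//= => /eqP[->]; exists C => //; rewrite setTI.
Qed.

(** The indices [None], [Some n], [Some m] give a threefold product formula, from which
    [fresh_sample_pair] makes the models and [xi n] the common past of [xi m]. *)
Lemma fresh_batch_pair n m : n != m ->
  fresh_sample P (fun u => (to_model_space u, xi n u)) (xi m) (D m).
Proof.
move=> nm.
apply: (@fresh_sample_pair _ _ _ _ _ _ _ _ _ P to_model_space (xi n) (xi m) (D n)).
move=> A C E mA mC mE; have [law ind] := fresh.
rewrite -!law//.
have := ind [set None; Some n; Some m]%SET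
  (fun k => if k is Some j then if j == n then xi n @^-1` C else xi m @^-1` E else A).
rewrite -finset.setUA big_setU1/= ?inE// big_setU1/= ?inE//=.
rewrite big_set1/= eqxx eq_sym (negbTE nm) => <-.
  congr (P _); apply/seteqP; split => u.
    move=> [Au [Cu Eu]] [k|] //; rewrite /= !inE/=.
    by case: ifP.
  move=> h; split; [apply: (h None)|split].
  - by rewrite /= !inE.
  - by have := h (Some n); rewrite /= eqxx; apply; rewrite !inE eqxx.
  - by have := h (Some m); rewrite /= eq_sym (negbTE nm); apply; rewrite !inE eqxx orbT.
move=> [k|]; rewrite !inE//=.
  case: ifP => [/eqP-> _|kn]; first by exists C => //; rewrite setTI.
  by move=> /orP[/eqP[kn']|/eqP[->]]; [rewrite kn' eqxx in kn|exists E => //; rewrite setTI].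
Qed.

End fresh_batches_theory.

Arguments to_model_space {R d N dT T P} x xl u.
Arguments measurable_central {R d N dT T P} x xl.
Arguments measurable_local {R d N dT T P} x xl n.

(** * Stochastic gradient noise *)

Section gradient_noise.
Context (R : realType) (d N : nat) (dT dB : measure_display)
  (T : measurableType dT) (B : measurableType dB) (P : probability T R)
  (D : 'I_N -> probability B R) (sigma : R)
  (Ln : 'I_N -> 'rV[R]_d -> R) (g : 'I_N -> 'rV[R]_d -> B -> 'rV[R]_d)
  (x : {RV P >-> 'rV[R]_d}) (xl : 'I_N -> {RV P >-> 'rV[R]_d})
  (xi : 'I_N -> {RV P >-> B}).
Hypothesis hdiff : forall n w, differentiable (Ln n) w.
Hypothesis hg : forall n, measurable_fun setT
  (fun p : 'rV[R]_d * B => g n p.1 p.2).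
Hypothesis hunbiased : forall n (w : 'rV[R]_d) (i : 'I_d),
  ('E_(D n)[fun b => g n w b ord0 i] = (grad (Ln n) w ord0 i)%:E)%E.
Hypothesis hvariance : forall n (w : 'rV[R]_d),
  ('E_(D n)[fun b => (enorm (g n w b - grad (Ln n) w) ^+ 2)%R]
     <= (sigma ^+ 2)%:E)%E.
Hypothesis hfresh : fresh_batches D x xl xi.

(** Taken as a function of a model and a batch rather than of an outcome, so that it can be
    integrated over [D n] at a frozen model and also evaluated along [xl n] and [xi n] under [P]. *)
Definition noise n (i : 'I_d) (p : 'rV[R]_d * B) : R :=
  g n p.1 p.2 ord0 i - grad (Ln n) p.1 ord0 i.

Lemma enorm_noise n w b :
  enorm (g n w b - grad (Ln n) w) ^+ 2 = \sum_i noise n i (w, b) ^+ 2.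
Proof. by rewrite enorm_sqr; apply: eq_bigr => i _; rewrite /noise !mxE. Qed.

Lemma measurable_noise n i : measurable_fun setT (noise n i).
Proof.
apply: measurable_funB.
  exact: (measurableT_comp (measurable_coord i) (hg n)).
exact: (measurableT_comp (measurable_grad i (hdiff n)) measurable_fst).
Qed.

Let measurable_noise_at n i w : measurable_fun setT (fun b => noise n i (w, b)).
Proof. exact: measurableT_comp (measurable_noise n i) (measurable_pair1 w). Qed.

Lemma noise_Lfun2 n i w : (fun b => noise n i (w, b)) \in Lfun (D n) 2%:E.
Proof.
apply: (Lfun2_expectation_sum_sqr (f := fun j b => noise n j (w, b))) => //.
apply: le_lt_trans (ltry (sigma ^+ 2)); apply: le_trans (hvariance n w).
rewrite le_eqVlt; apply/orP; left; apply/eqP; congr ('E_(D n)[_])%E.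
by apply/funext => b; rewrite enorm_noise.
Qed.

(** The variance bound makes the noise integrable, so the expectation of [g n] splits into noise
    plus gradient, and unbiasedness cancels the finite gradient term. *)
Lemma noise_centered n i w : (\int[D n]_b (noise n i (w, b))%:E = 0)%E.
Proof.
have nL1 : (fun b => noise n i (w, b)) \in Lfun (D n) 1.
  by apply: Lfun_subset12 (noise_Lfun2 n i w); exact: fin_num_measure.
have cL1 : cst (grad (Ln n) w ord0 i) \in Lfun (D n) 1 by exact: Lfun_cst.
have := hunbiased n w i.
rewrite (_ : (fun b => g n w b ord0 i) =
  (fun b => noise n i (w, b)) \+ cst (grad (Ln n) w ord0 i)); last first.
  by apply/funext => b; rewrite /noise/= subrK.
have nfin := fineK (expectation_fin_num nL1).
rewrite expectationD// expectation_cst -nfin -EFinD => -[] /eqP.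
rewrite -subr_eq0 addrK => /eqP n0.
by move: nfin; rewrite n0 unlock => <-.
Qed.

Let e n i (u : T) : R := noise n i (xl n u, xi n u).

Let measurable_xlxi n : measurable_fun setT (fun u => (xl n u, xi n u)).
Proof. exact: measurable_fun_pair. Qed.

Let measurable_e n i : measurable_fun setT (e n i).
Proof. exact: measurableT_comp (measurable_noise n i) (measurable_xlxi n). Qed.

Let S : measurableType _ := model_space x xl.

Let measurable_noiseS n i : measurable_fun setT
  (fun p : S * B => noise n i (xl n p.1, p.2)).
Proof.
apply: (measurableT_comp (measurable_noise n i)).
apply: measurable_fun_pair; last exact: measurable_snd.
exact: (measurableT_comp (measurable_local x xl n) (@measurable_fst _ _ S B)).
Qed.

(** The variance bound holds at every frozen model; freshness lets it be averaged over the law of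
    the models. *)
Lemma expectation_noise_sqr n :
  ('E_P[fun u => (\sum_i noise n i (xl n u, xi n u) ^+ 2)%R] <= (sigma ^+ 2)%:E)%E.
Proof.
rewrite unlock.
pose f (p : S * B) : \bar R := (\sum_i noise n i (xl n p.1, p.2) ^+ 2)%:E.
have mf : measurable_fun setT f.
  by apply/measurable_EFinP; apply: measurable_sum => i; exact: measurable_funX.
have f0 p : (0 <= f p)%E.
  by rewrite lee_fin; apply: sumr_ge0 => i _; rewrite sqr_ge0.
have := ge0_integral_fresh_sample (fresh_batch hfresh n) mf f0.
rewrite /f/= => ->.
apply: (@le_trans _ _ (\int[distribution P (to_model_space x xl)]_z (sigma ^+ 2)%:E)%E).
  apply: ge0_le_integral => //.
  - by move=> z _; apply: integral_ge0 => b _; exact: (f0 (z, b)).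
  - exact: (measurable_fun_fubini_tonelli_F _ mf).
  move=> z _; have := hvariance n (xl n z); rewrite unlock.
  by under eq_integral do rewrite enorm_noise.
by rewrite integral_cst// [X in (_ * X)%E](_ : _ = 1%E) ?mule1//; exact: (probability_setT P).
Qed.

Lemma noise_sample_Lfun2 n i :
  (fun u => noise n i (xl n u, xi n u)) \in Lfun P 2%:E.
Proof.
apply: (Lfun2_expectation_sum_sqr (f := fun j u => noise n j (xl n u, xi n u))).
  exact: measurable_e.
exact: le_lt_trans (expectation_noise_sqr n) (ltry _).
Qed.

(** [V] depends on the models only, so it is constant once they are frozen, and the noise then
    averages to zero over [D n]. Square integrability of both factors makes the product
    integrable. *)
Lemma expectation_model_noise n i (V : S -> R) :
  measurable_fun setT V -> (V : T -> R) \in Lfun P 2%:E ->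
  ('E_P[fun u => (V u * noise n i (xl n u, xi n u))%R] = 0)%E.
Proof.
move=> mV V2; rewrite unlock.
pose f (p : S * B) : \bar R := (V p.1 * noise n i (xl n p.1, p.2))%:E.
apply: (@integral_fresh_sample_centered _ _ _ _ _ _ _ _ _ _ _ (fresh_batch hfresh n) f).
- apply/measurable_EFinP; apply: measurable_funM => //.
  exact: measurableT_comp mV measurable_fst.
- by apply/Lfun1_integrable; apply: Lfun2_mul_Lfun1 => //; exact: noise_sample_Lfun2.
- move=> z; rewrite /f/=; under eq_integral do rewrite EFinM.
  rewrite integralZl// ?noise_centered ?mule0//.
  apply/Lfun1_integrable.
  by apply: Lfun_subset12 (noise_Lfun2 n i _); exact: fin_num_measure.
Qed.

(** The models and the batch of [n] are frozen together; the batch of [m] is fresh relative to both,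
    so its noise averages to zero. *)
Lemma expectation_noise_noise n m i : n != m ->
  ('E_P[fun u => (noise n i (xl n u, xi n u) * noise m i (xl m u, xi m u))%R] = 0)%E.
Proof.
move=> nm; rewrite unlock.
have mZ : measurable_fun setT (fun u => (to_model_space x xl u, xi n u)).
  exact: measurable_fun_pair.
pose Z : {mfun T >-> (S * B)%type} := HB.pack
  (fun u => (to_model_space x xl u, xi n u))
  (isMeasurableFun.Build _ _ _ _ _ mZ).
pose f (p : S * B * B) : \bar R :=
  (noise n i (xl n p.1.1, p.1.2) * noise m i (xl m p.1.1, p.2))%:E.
have mf1 : measurable_fun setT (fun p : S * B * B => noise n i (xl n p.1.1, p.1.2)).
  exact: (measurableT_comp (measurable_noiseS n i) measurable_fst).
have mf2 : measurable_fun setT (fun p : S * B * B => noise m i (xl m p.1.1, p.2)).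
  apply: (measurableT_comp (measurable_noiseS m i) (g := fun p : S * B * B => (p.1.1, p.2))).
  apply: measurable_fun_pair; last exact: measurable_snd.
  exact: measurableT_comp measurable_fst measurable_fst.
apply: (@integral_fresh_sample_centered _ _ _ _ _ _ _ _ Z _ _ (fresh_batch_pair hfresh nm) f).
- by apply/measurable_EFinP; exact: measurable_funM.
- apply/Lfun1_integrable.
  by apply: Lfun2_mul_Lfun1; exact: noise_sample_Lfun2.
- move=> z; rewrite /f/=; under eq_integral do rewrite EFinM.
  rewrite integralZl// ?noise_centered ?mule0//.
  apply/Lfun1_integrable.
  by apply: Lfun_subset12 (noise_Lfun2 m i _); exact: fin_num_measure.
Qed.

(** After the squares are expanded, terms of distinct clients vanish by [expectation_noise_noise]
    and only the diagonal remains. *)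
Lemma expectation_weighted_noise_sqr (alpha : 'I_N -> R) :
  ('E_P[fun u => (\sum_i (\sum_n alpha n * noise n i (xl n u, xi n u)) ^+ 2)%R]
   <= (sigma ^+ 2 * \sum_n alpha n ^+ 2)%:E)%E.
Proof.
have e1 n m i : (fun u => e n i u * e m i u) \in Lfun P 1.
  by apply: Lfun2_mul_Lfun1; exact: noise_sample_Lfun2.
have e2 i : (fun u => \sum_n \sum_m alpha n * alpha m * (e n i u * e m i u)) \in Lfun P 1.
  by apply: Lfun_bigsum => // n; apply: Lfun_bigsum => // m; exact: Lfun_mull.
rewrite (_ : (fun u => _) = (fun u =>
    \sum_i \sum_n \sum_m alpha n * alpha m * (e n i u * e m i u))); last first.
  apply/funext => u; apply: eq_bigr => i _.
  rewrite expr2 mulr_suml; apply: eq_bigr => n _; rewrite mulr_sumr.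
  by apply: eq_bigr => m _; rewrite /e; ring.
rewrite expectation_bigsum//.
rewrite (eq_bigr (fun i =>
    \sum_n (alpha n ^+ 2)%:E * 'E_P[fun u => (e n i u ^+ 2)%R])%E); last first.
  move=> i _; rewrite expectation_bigsum; last first.
    by move=> n; apply: Lfun_bigsum => // m; exact: Lfun_mull.
  apply: eq_bigr => n _; rewrite expectation_bigsum; last first.
    by move=> m; exact: Lfun_mull.
  rewrite (bigD1 n)//= big1 ?adde0; last first.
    by move=> m mn; rewrite expectation_mull// expectation_noise_noise ?mule0// eq_sym.
  by rewrite expectation_mull.
(* Clients are summed outermost to gather all coordinates of one client's noise, since the variance
   bound concerns the full Euclidean norm. *)
rewrite exchange_big/= mulr_sumr -sumEFin; apply: lee_sum => n _.
rewrite -ge0_sume_distrr; last first.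
  by move=> i _; apply: expectation_ge0 => u; rewrite sqr_ge0.
rewrite -expectation_bigsum; last by move=> i; exact: e1.
rewrite mulrC [leRHS]EFinM; apply: lee_wpmul2l; first by rewrite lee_fin sqr_ge0.
exact: expectation_noise_sqr.
Qed.

Lemma expectation_model_weighted_noise (alpha : 'I_N -> R) (V : 'I_d -> S -> R) :
  (forall i, measurable_fun setT (V i)) ->
  (forall i, (V i : T -> R) \in Lfun P 2%:E) ->
  ('E_P[fun u => (\sum_i V i u * \sum_n alpha n * noise n i (xl n u, xi n u))%R] = 0)%E.
Proof.
move=> mV V2.
have Ve n i : (fun u => V i u * e n i u) \in Lfun P 1.
  by apply: Lfun2_mul_Lfun1 => //; exact: noise_sample_Lfun2.
rewrite (_ : (fun u => _) = (fun u =>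
    \sum_i \sum_n alpha n * (V i u * e n i u))); last first.
  apply/funext => u; apply: eq_bigr => i _; rewrite mulr_sumr.
  by apply: eq_bigr => n _; rewrite mulrCA.
rewrite expectation_bigsum; last first.
  by move=> i; apply: Lfun_bigsum => // n; exact: Lfun_mull.
rewrite big1// => i _; rewrite expectation_bigsum; last first.
  by move=> n; exact: Lfun_mull.
by rewrite big1// => n _; rewrite expectation_mull// expectation_model_noise// mule0.
Qed.

End gradient_noise.

(** * One step of the update *)

Lemma differentiable_global_loss (R : realType) (d N : nat) (alpha : 'I_N -> R)
    (Ln : 'I_N -> 'rV[R]_d -> R) (w : 'rV[R]_d) :
  (forall n, differentiable (Ln n) w) -> differentiable (global_loss alpha Ln) w.
Proof.
move=> df.
rewrite (_ : global_loss alpha Ln = \sum_(n < N) alpha n *: Ln n).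
  by apply: differentiable_sum => n; exact: differentiableZ.
by apply/funext => v; rewrite fct_sumE.
Qed.

(** The deterministic inequality behind the theorem: [s n] stands for the stochastic gradient and
    [h n] for the true local one. Both sides are sums over coordinates once [descent] is applied,
    and they are compared coordinate by coordinate. *)
Lemma descent_step (R : realType) (d N : nat) (alpha : 'I_N -> R) (eta beta : R)
    (f : 'rV[R]_d -> R) (h s : 'I_N -> 'rV[R]_d) (w : 'rV[R]_d) :
  (forall n, 0 <= alpha n) -> \sum_n alpha n = 1 -> 0 <= eta -> 0 <= beta ->
  eta * beta <= 1 -> (forall v, differentiable f v) ->
  (forall w1 w2, enorm (grad f w1 - grad f w2) <= beta * enorm (w1 - w2)) ->
  f (w - eta *: \sum_n alpha n *: s n) <=
    f w - eta / 2 * enorm (grad f w) ^+ 2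
    + eta ^+ 2 * beta / 2 *
        \sum_i (\sum_n alpha n * (s n ord0 i - h n ord0 i)) ^+ 2
    + eta / 2 * \sum_n alpha n * enorm (grad f w - h n) ^+ 2
    - eta * \sum_i (grad f w ord0 i - eta * beta * \sum_n alpha n * h n ord0 i) *
        \sum_n alpha n * (s n ord0 i - h n ord0 i).
Proof.
move=> alpha0 alpha1 eta0 beta0 etabeta df fL.
have subE (a b : 'rV[R]_d) i : (a - b) ord0 i = a ord0 i - b ord0 i by rewrite !mxE.
apply: le_trans (descent beta0 df fL _ _) _.
rewrite !enorm_sqr.
under [X in _ <= _ + eta / 2 * X - _]eq_bigr do rewrite enorm_sqr mulr_sumr.
rewrite [X in _ <= _ + eta / 2 * X - _]exchange_big/=.
rewrite -!addrA lerD2l !mulr_sumr -!sumrN -!big_split/=.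
apply: ler_sum => i _.
set G := grad f w ord0 i.
set E := \sum_n alpha n * (s n ord0 i - h n ord0 i).
set H := \sum_n alpha n * h n ord0 i.
have -> : (- (eta *: \sum_n alpha n *: s n)) ord0 i = - eta * (H + E).
  rewrite !mxE summxE /H /E -big_split/= mulNr; congr (- (_ * _)).
  by apply: eq_bigr => n _; rewrite mxE; ring.
have jensen : (G - H) ^+ 2 <= \sum_n alpha n * (grad f w - h n) ord0 i ^+ 2.
  apply: le_trans (sqr_convex_sum (fun n => (grad f w - h n) ord0 i) alpha0 alpha1).
  rewrite (_ : G - H = \sum_n alpha n * (grad f w - h n) ord0 i)//.
  rewrite /H -[G]mul1r -alpha1 mulr_suml -sumrB.
  by apply: eq_bigr => n _; rewrite subE mulrBr.
(* This is what polarizing <G, H> leaves over in H^2; the step size condition gives its sign. *)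
have : 0 <= eta / 2 * (1 - eta * beta) * H ^+ 2.
  by rewrite mulr_ge0 ?sqr_ge0// mulr_ge0 ?divr_ge0// subr_ge0.
have : eta / 2 * (G - H) ^+ 2 <=
    eta / 2 * \sum_n alpha n * (grad f w - h n) ord0 i ^+ 2.
  by rewrite ler_wpM2l// divr_ge0.
set Q := \sum_n alpha n * (grad f w - h n) ord0 i ^+ 2.
move=> h1 h2.
(* The right side minus the left side is exactly the Jensen gap plus the leftover in H^2. *)
rewrite -subr_ge0.
apply: le_trans (addr_ge0 (_ : 0 <= eta / 2 * Q - eta / 2 * (G - H) ^+ 2) h2) _.
  by rewrite subr_ge0.
by rewrite le_eqVlt; apply/orP; left; apply/eqP; field.
Qed.

(** Expectations are extended reals, so the discrepancies may be +oo; [hloss] and [hgrad] keep the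
    loss and gradient terms on the right finite. *)
Theorem theorem1 (R : realType) (d N : nat)
  (dT dB : measure_display) (T : measurableType dT) (B : measurableType dB)
  (P : probability T R)
  (D : 'I_N -> probability B R)
  (alpha : 'I_N -> R) (eta beta sigma : R)
  (Ln : 'I_N -> 'rV[R]_d -> R)
  (g : 'I_N -> 'rV[R]_d -> B -> 'rV[R]_d)
  (x : nat -> {RV P >-> 'rV[R]_d})
  (xl : 'I_N -> nat -> {RV P >-> 'rV[R]_d})
  (xi : 'I_N -> nat -> {RV P >-> B})
  (t : nat)
  (halpha0 : forall n, 0 <= alpha n)
  (halpha1 : \sum_n alpha n = 1)
  (heta0 : 0 < eta)
  (hbeta0 : 0 <= beta)
  (hetabeta : eta * beta <= 1)
  (hdiff : forall n w, differentiable (Ln n) w)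
  (hg : forall n, measurable_fun setT
          (fun p : 'rV[R]_d * B => g n p.1 p.2))
  (hsmooth : forall w1 w2 : 'rV[R]_d,
     enorm (grad (global_loss alpha Ln) w1 - grad (global_loss alpha Ln) w2)
       <= beta * enorm (w1 - w2))
  (hunbiased : forall n (w : 'rV[R]_d) (i : 'I_d),
     ('E_(D n)[fun b => g n w b ord0 i] = (grad (Ln n) w ord0 i)%:E)%E)
  (hvariance : forall n (w : 'rV[R]_d),
     ('E_(D n)[fun b => (enorm (g n w b - grad (Ln n) w) ^+ 2)%R]
        <= (sigma ^+ 2)%:E)%E)
  (hfresh : fresh_batches D (x t) (xl ^~ t) (xi ^~ t))
  (hupdate : forall u : T,
     x t.+1 u = x t u - eta *: \sum_n alpha n *: g n (xl n t u) (xi n t u))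
  (hloss : P.-integrable setT
     (fun u => (global_loss alpha Ln (x t u))%:E))
  (hgrad : ('E_P[fun u => (enorm (grad (global_loss alpha Ln) (x t u)) ^+ 2)%R]
              < +oo)%E) :
  ('E_P[fun u => global_loss alpha Ln (x t.+1 u)] <=
     'E_P[fun u => global_loss alpha Ln (x t u)]
     - (eta / 2)%:E *
         'E_P[fun u => (enorm (grad (global_loss alpha Ln) (x t u)) ^+ 2)%R]
     + (eta ^+ 2 * beta / 2 * sigma ^+ 2 * \sum_n alpha n ^+ 2)%:E
     + (eta / 2)%:E *
         \sum_n (alpha n)%:E *
           'E_P[fun u => (enorm (grad (global_loss alpha Ln) (x t u)
                                 - grad (Ln n) (xl n t u)) ^+ 2)%R])%E.
Proof.
pose F := global_loss alpha Ln.
have dF w : differentiable F w by exact: differentiable_global_loss.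
have cF : continuous F by move=> w; exact: differentiable_continuous.
pose G i (u : T) : R := grad F (x t u) ord0 i.
pose h n i (u : T) : R := grad (Ln n) (xl n t u) ord0 i.
pose Q n (u : T) : R := enorm (grad F (x t u) - grad (Ln n) (xl n t u)) ^+ 2.
pose q n := ('E_P[Q n])%E.
have q0 n : (0 <= q n)%E by apply: expectation_ge0 => u; exact: sqr_ge0.
have mG i : measurable_fun setT (G i).
  by apply: (measurableT_comp (measurable_grad i dF)); exact: measurable_funP.
have mh n i : measurable_fun setT (h n i).
  by apply: (measurableT_comp (measurable_grad i (hdiff n))); exact: measurable_funP.
have QE n u : Q n u = \sum_i (G i u - h n i u) ^+ 2.
  rewrite /Q enorm_sqr; apply: eq_bigr => i _; congr (_ ^+ 2).
  by rewrite mxE [in X in _ + X]mxE.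
pose A2 (u : T) : R := enorm (grad F (x t u)) ^+ 2.
have A2E : A2 = fun u => \sum_i G i u ^+ 2.
  by apply/funext => u; exact: enorm_sqr.
have G2 i : G i \in Lfun P 2%:E.
  by apply: (Lfun2_expectation_sum_sqr (f := G)) => //; rewrite -A2E.
have A2L : A2 \in Lfun P 1.
  rewrite A2E; apply: Lfun_bigsum => // i.
  exact: (Lfun2_mul_Lfun1 (G2 i) (G2 i)).
have LL : (fun u => F (x t u)) \in Lfun P 1 by exact/Lfun1_integrable.
(* Finiteness of these terms excludes a sum of -oo and +oo when the discrepancy is infinite. *)
have rhs_fin : ('E_P[fun u => F (x t u)] - (eta / 2)%:E * 'E_P[A2]
    + (eta ^+ 2 * beta / 2 * sigma ^+ 2 * \sum_n alpha n ^+ 2)%:E)%E \is a fin_num.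
  by rewrite fin_numD/= fin_numB expectation_fin_num//= fin_numM// expectation_fin_num.
(* If some weighted discrepancy has infinite expectation, the right-hand side is +oo;
   otherwise alpha n * h n is square integrable, as G and G - h n are. *)
have [[n /andP[an qn]]|fin] := pselect (exists n, (alpha n != 0) && (q n == +oo)%E).
  have sum_oo : (\sum_n (alpha n)%:E * q n = +oo)%E.
    rewrite (bigD1 n)//= (eqP qn) gt0_muley ?lte_fin ?lt0r ?an//=.
    rewrite addye// gt_eqF// (lt_le_trans (ltNyr 0))//.
    by apply: sume_ge0 => m _; apply: mule_ge0; [rewrite lee_fin|exact: q0].
  rewrite [X in (_ <= _ + _ * X)%E](_ : _ = +oo)%E; last exact: sum_oo.
  rewrite gt0_muley ?lte_fin ?divr_gt0// addey ?leey//.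
  by move: rhs_fin; rewrite fin_numE => /andP[].
have l12 : (1 <= 2%:E :> \bar R)%E by rewrite lee1n.
have qfin n : alpha n = 0 \/ (q n < +oo)%E.
  case: (eqVneq (alpha n) 0) => [|an]; [by left|right].
  rewrite ltey; apply/eqP => qn; apply: fin; exists n.
  by rewrite an; exact/eqP.
have hL n i : (fun u => alpha n * h n i u) \in Lfun P 2%:E.
  have [->|qn] := qfin n.
    by rewrite (_ : (fun u => _) = cst 0) ?Lfun_cst//; apply/funext => u; rewrite mul0r.
  have dL : (fun u => G i u - h n i u) \in Lfun P 2%:E.
    apply: (Lfun2_expectation_sum_sqr (f := fun i u => G i u - h n i u)).
      by move=> j; exact: measurable_funB.
    by rewrite (_ : (fun u => _) = Q n)//; apply/funext => u; rewrite QE.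
  apply: Lfun_mull => //.
  rewrite (_ : h n i = G i - (fun u => G i u - h n i u)); first exact: rpredB.
  by apply/funext => u; rewrite -[RHS]/(G i u - (G i u - h n i u)) subKr.
(* A client of weight zero may still have infinite [q n]; the convention that 0 times +oo is 0 then
   makes both sides vanish. *)
have QL n : (fun u => alpha n * Q n u) \in Lfun P 1 /\
    ('E_P[fun u => (alpha n * Q n u)%R] = (alpha n)%:E * q n)%E.
  have [->|qn] := qfin n.
    rewrite (_ : (fun u => _) = cst 0).
      by rewrite Lfun_cst expectation_cst mul0e.
    by apply/funext => u; rewrite mul0r.
  have QL : Q n \in Lfun P 1.
    apply/Lfun1_integrable/integrableP; split.
      apply/measurable_EFinP; rewrite (_ : Q n = fun u => \sum_i (G i u - h n i u) ^+ 2).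
        by apply: measurable_sum => i; apply: measurable_funX; exact: measurable_funB.
      exact/funext.
    move: qn; rewrite /q unlock; congr (_ < _)%E; apply: eq_integral => u _ /=.
    by rewrite ger0_norm// sqr_ge0.
  by rewrite expectation_mull//; split => //; exact: Lfun_mull.
(* The factor of the noise in the cross term of [descent_step], a function of the models only. *)
pose V i (u : T) : R := G i u - eta * beta * \sum_n alpha n * h n i u.
pose e n i (u : T) : R := noise Ln g n i (xl n t u, xi n t u).
pose E2 (u : T) : R := \sum_i (\sum_n alpha n * e n i u) ^+ 2.
pose C (u : T) : R := \sum_i V i u * \sum_n alpha n * e n i u.
have eL n i : e n i \in Lfun P 2%:E.
  exact: (noise_sample_Lfun2 hdiff hg hvariance hfresh).
have VL i : V i \in Lfun P 2%:E.
  rewrite (_ : V i = G i - (fun u => eta * beta * \sum_n alpha n * h n i u))//.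
  by apply: rpredB => //; apply: Lfun_mull => //; exact: Lfun_bigsum.
have sL i : (fun u => \sum_n alpha n * e n i u) \in Lfun P 2%:E.
  by apply: Lfun_bigsum => // n; exact: Lfun_mull.
have E2L : E2 \in Lfun P 1.
  by apply: Lfun_bigsum => // i; exact: (Lfun2_mul_Lfun1 (sL i) (sL i)).
have CL : C \in Lfun P 1.
  by apply: Lfun_bigsum => // i; exact: (Lfun2_mul_Lfun1 (VL i) (sL i)).
have SL : (fun u => \sum_n alpha n * Q n u) \in Lfun P 1.
  by apply: Lfun_bigsum => // n; exact: (QL n).1.
pose k := eta ^+ 2 * beta / 2.
(* What has to be checked is that [V] is measurable for the sigma-algebra of the models, not merely
   for that of [T]. *)
have C0 : ('E_P[C] = 0)%E.
  apply: (expectation_model_weighted_noise hdiff hg hunbiased hvariance hfresh) => i //.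
  apply: measurable_funB.
    exact: (measurableT_comp (measurable_grad i dF) (measurable_central (x t) (xl ^~ t))).
  apply: (measurable_funM (f := cst _)); first exact: measurable_cst.
  apply: measurable_sum => n.
  apply: (measurable_funM (f := cst _)); first exact: measurable_cst.
  exact: (measurableT_comp (measurable_grad i (hdiff n))
    (measurable_local (x t) (xl ^~ t) n)).
have E2s : ('E_P[E2] <= (sigma ^+ 2 * \sum_n alpha n ^+ 2)%:E)%E.
  exact: (expectation_weighted_noise_sqr hdiff hg hunbiased hvariance hfresh).
(* The bound of [descent_step] is built up one integrable term at a time, so that its expectation
   can be split term by term. *)
pose U1 := (fun u => F (x t u)) \+ (fun u => - (eta / 2) * A2 u).
pose U2 := U1 \+ (fun u => k * E2 u).
pose U3 := U2 \+ (fun u => eta / 2 * \sum_n alpha n * Q n u).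
pose U := U3 \+ (fun u => - eta * C u).
have kA2 := Lfun_mull (lexx 1%E) (- (eta / 2)) A2L.
have kE2 := Lfun_mull (lexx 1%E) k E2L.
have kS := Lfun_mull (lexx 1%E) (eta / 2) SL.
have kC := Lfun_mull (lexx 1%E) (- eta) CL.
have U1L : U1 \in Lfun P 1 by exact: rpredD.
have U2L : U2 \in Lfun P 1 by exact: rpredD.
have U3L : U3 \in Lfun P 1 by exact: rpredD.
have UL : U \in Lfun P 1 by exact: rpredD.
apply: (@le_trans _ _ ('E_P[U])%E).
  apply: expectation_le_Lfun1 => //.
    apply: (measurableT_comp (continuous_measurable_rV cF)); exact: measurable_funP.
  move=> u; rewrite hupdate.
  apply: le_trans (descent_step (fun n => grad (Ln n) (xl n t u)) _ _ halpha0 halpha1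
    (ltW heta0) hbeta0 hetabeta dF hsmooth) _.
  by rewrite /U /U3 /U2 /U1 /= !mulNr; exact: lexx.
rewrite /U expectationD// (expectation_mull _ CL) C0 mule0 adde0.
rewrite /U3 expectationD// (expectation_mull _ SL) expectation_bigsum; last first.
  by move=> n; exact: (QL n).1.
rewrite (eq_bigr (fun n => (alpha n)%:E * q n)%E); last by move=> n _; exact: (QL n).2.
apply: leeD2r.
rewrite /U2 expectationD// (expectation_mull _ E2L).
rewrite /U1 expectationD// (expectation_mull _ A2L).
rewrite EFinN mulNe; apply: leeD2l.
rewrite -[(eta ^+ 2 * beta / 2)%R]/k -mulrA [leRHS]EFinM; apply: lee_wpmul2l => //.
by rewrite lee_fin /k divr_ge0// mulr_ge0// sqr_ge0.
Qed.
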